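(* Let $\mathcal{P}$ be the set of prime numbers and let $\mathcal{F}$ be the mapping from $\{0,1\}^{\mathbb{N}}$ to sets of positive integers, associated with the coprimality operator $\mathcal{J}$, defined in the context. Then $\mathcal{F}(0\|\mathbf{1}_\infty)=\mathcal{P}$ and $\mathcal{F}(\mathbf{1}_\infty)=\{1\}\cup\mathcal{P}$, where $\mathbf{1}_\infty=111\ldots$ is the all-one infinite sequence and $0\|\mathbf{1}_\infty=0111\ldots$ is the concatenation of $0$ and $\mathbf{1}_\infty$.
   Context: $\mathbb{N}=\{1,2,\ldots\}$. For $A\subseteq\mathbb{N}$ let $\mathrm{PF}(A)=\{p\in\mathcal{P}\colon p\mid a\text{ for some }a\in A\}$ and $\mathcal{J}(A)=\{a\in\mathbb{N}\colon p\mid a\text{ for some }p\in\mathrm{PF}(A)\}$. Definition of $\mathcal{F}$: given $\sigma=(\sigma_n)_{n\in\mathbb{N}}\in\{0,1\}^{\mathbb{N}}$, put $A_0=B_0=\emptyset$. For $n=1,2,\ldots$ let $a_n$ be the smallest positive integer not in $A_{n-1}\cup\mathcal{J}(A_{n-1})\cup B_{n-1}$. If $\sigma_n=1$, set $A_n=A_{n-1}\cup\{a_n\}$ and $B_n=B_{n-1}$; if $\sigma_n=0$, set $A_n=A_{n-1}$ and $B_n=B_{n-1}\cup\{a_n\}$. Then $\mathcal{F}(\sigma)=\bigcup_{n=1}^{\infty}A_n$. *)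

(* Defs.v *)
From mathcomp Require Import all_boot.
From mathcomp Require Import boolp classical_sets functions cardinality.

Set Implicit Arguments.
Unset Strict Implicit.
Unset Printing Implicit Defensive.

Local Open Scope classical_set_scope.
Local Open Scope nat_scope.

(* Positive integers are the nonzero elements of nat; sets of positive
   integers are sets of nat without 0. *)

Definition Primes : set nat := [set p | prime p].

Definition PF (A : set nat) : set nat :=
  [set p | prime p /\ exists2 a, A a & p %| a].

Definition J (A : set nat) : set nat :=
  [set a | 0 < a /\ exists2 p, PF A p & p %| a].

Definition admissible (A B : set nat) : set nat :=
  [set a | 0 < a /\ ~ (A `|` J A `|` B) a].

Definition least (X : set nat) (a : nat) : Prop :=
  X a /\ forall b, X b -> a <= b.

(* The default value 0 is never reached in the construction below: see
   next_least and next_stage. *)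
Definition next (A B : set nat) : nat := xget 0 (least (admissible A B)).

(* A binary sequence is indexed from 0: its term number n >= 1 in the usual
   numbering is sigma n.-1. Stage n of the construction is (A_n, B_n). *)
Fixpoint stage (sigma : nat -> bool) (n : nat) : set nat * set nat :=
  if n is m.+1 then
    let: (A, B) := stage sigma m in
    let a := next A B in
    if sigma m then (A `|` [set a], B) else (A, B `|` [set a])
  else (set0, set0).

Definition F (sigma : nat -> bool) : set nat :=
  \bigcup_(n in [set n | 1 <= n]) (stage sigma n).1.

Definition ones : nat -> bool := fun=> true.

Definition scat (w : seq bool) (s : nat -> bool) : nat -> bool :=
  fun n => if n < size w then nth false w n else s (n - size w).

Lemma finite_set_bounded (A : set nat) :
  finite_set A -> exists m, forall a, A a -> a <= m.
Proof.
move=> /finite_seqP[s ->]; exists (\max_(i <- s) i) => a /= sa.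
by rewrite (big_rem a) //= leq_maxl.
Qed.

(* Any large enough prime is admissible. *)
Lemma admissible_nonempty (A B : set nat) :
  finite_set A -> finite_set B -> (forall a, A a -> 0 < a) ->
  exists a, admissible A B a.
Proof.
move=> /finite_set_bounded[m mA] /finite_set_bounded[k kB] A0.
have [p mp pp] := prime_above (maxn m k).
have [mp' kp] : m < p /\ k < p by move: mp; rewrite gtn_max => /andP.
exists p; split; first exact: prime_gt0.
move=> [[/mA|[_ [q [qp [a Aa qa]]]]]|/kB].
- by rewrite leqNgt mp'.
- rewrite (dvdn_prime2 qp pp) => /eqP qE; move: qa; rewrite qE.
  by move=> /(dvdn_leq (A0 _ Aa)); rewrite leqNgt (leq_ltn_trans (mA _ Aa) mp').
- by rewrite leqNgt kp.
Qed.

Lemma next_least (A B : set nat) :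
  finite_set A -> finite_set B -> (forall a, A a -> 0 < a) ->
  least (admissible A B) (next A B).
Proof.
move=> fA fB A0; have [a Xa] := admissible_nonempty fA fB A0.
have ex : exists a, `[< admissible A B a >] by exists a; apply/asboolP.
apply: (@xgetPex _ 0 (least (admissible A B))).
case: (ex_minnP ex) => b /asboolP Xb bmin; exists b; split=> // c Xc.
by apply: bmin; apply/asboolP.
Qed.

Lemma stage_wf (sigma : nat -> bool) (n : nat) :
  [/\ finite_set (stage sigma n).1, finite_set (stage sigma n).2 &
      forall a, (stage sigma n).1 a -> 0 < a].
Proof.
elim: n => [|n] /=; first by split.
case: (stage sigma n) => A B /= [fA fB A0].
have [[next0 _] _] := next_least fA fB A0.
case: (sigma n) => /=; split=> //; rewrite ?finite_setU; try by split.
by move=> a [/A0|->].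
Qed.

Lemma next_stage (sigma : nat -> bool) (n : nat) :
  let: (A, B) := stage sigma n in least (admissible A B) (next A B).
Proof.
have := stage_wf sigma n; case: (stage sigma n) => A B /= [fA fB A0].
exact: next_least.
Qed.

(* Main.v *)
Require Import Defs.
From mathcomp Require Import all_boot.
From mathcomp Require Import boolp classical_sets.

Local Open Scope classical_set_scope.
Local Open Scope nat_scope.

(* Otherwise [next] would be the successor in a cyclic sequence. *)
Local Notation next := Defs.next.

(** The first term decides whether 1 is accepted (put in A) or rejected (put in
    B); no prime divides 1, so either way 1 excludes no other integer.  If every
    later term accepts, the construction is then a sieve of Eratosthenes.  The
    least candidate [a > 1] is prime: otherwise its least prime divisor, being
    smaller than [a], is already excluded, and a prime can only be excluded
    together with all its multiples ([least_admissible_prime]).  Every prime is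
    reached, since after [n] stages each of the integers 1, ..., n has been
    decided ([stage_exhausts]), and a prime is excluded by a set of primes only
    if it belongs to that set.  Hence the result is the set of primes, together
    with 1 exactly when the first term is 1 ([F_eventually_ones]). *)

Lemma prime_JE (A : set nat) p :
  prime p -> J A p -> exists2 a, A a & p %| a.
Proof.
move=> pp [_ [q [qp Aq]]].
by rewrite (dvdn_prime2 qp pp) => /eqP <-.
Qed.

(** A prime that is not admissible is in [A] or in [J A], since [B] contains no
    prime; in both cases [J A] contains all its multiples.  Applied to the least
    prime divisor of [a], this contradicts the minimality of a composite [a]. *)
Lemma least_admissible_prime (A B : set nat) a :
  (A `|` B) 1 -> B `<=` [set 1] -> least (admissible A B) a -> prime a.
Proof.
move=> AB1 B1 [[a0 Na] amin].
have a1 : 1 < a.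
  rewrite ltn_neqAle a0 andbT; apply/eqP => aE; apply: Na; rewrite -aE.
  by case: AB1 => ?; [left; left | right].
have pp := pdiv_prime a1.
suff paE : pdiv a = a by rewrite -paE.
apply/eqP; rewrite eqn_leq pdiv_leq //=; apply: amin; split.
  exact: prime_gt0.
move=> excl; apply: Na; left; right; split=> //.
exists (pdiv a); last exact: pdiv_dvd.
split=> //; case: excl => [[Ap|]|/B1 pE].
- by exists (pdiv a).
- exact: prime_JE.
- by move: pp; rewrite pE.
Qed.

Lemma next_stageP sigma n :
  least (admissible (stage sigma n).1 (stage sigma n).2)
        (next (stage sigma n).1 (stage sigma n).2).
Proof. by have := next_stage sigma n; case: (stage sigma n). Qed.

Lemma stageS sigma n :
  stage sigma n.+1 =
  let a := next (stage sigma n).1 (stage sigma n).2 in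
  if sigma n then ((stage sigma n).1 `|` [set a], (stage sigma n).2)
  else ((stage sigma n).1, (stage sigma n).2 `|` [set a]).
Proof. by rewrite /=; case: (stage sigma n). Qed.

Lemma admissibleS (A B A' B' : set nat) :
  A `<=` A' -> B `<=` B' -> admissible A' B' `<=` admissible A B.
Proof.
move=> AA' BB' a [a0 Na]; split=> // excl; apply: Na.
case: excl => [[/AA'|[_ [p [pp [b /AA' A'b pb]] pa]]]|/BB'].
- by left; left.
- by left; right; split=> //; exists p => //; split=> //; exists b.
- by right.
Qed.

Lemma admissible_stageS sigma n a :
  admissible (stage sigma n.+1).1 (stage sigma n.+1).2 a ->
  admissible (stage sigma n).1 (stage sigma n).2 a /\
  a <> next (stage sigma n).1 (stage sigma n).2.
Proof.
move=> adm; split.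
  by move: adm; rewrite stageS /=; case: (sigma n); apply: admissibleS => // x; left.
move=> aE; case: adm => _; apply; rewrite stageS /= -aE.
by case: (sigma n) => /=; [left; left; right | right; right].
Qed.

(** Each stage decides the least admissible integer, and what is decided or
    excluded stays so; hence the least admissible integer increases. *)
Lemma stage_exhausts sigma n a :
  admissible (stage sigma n).1 (stage sigma n).2 a -> n < a.
Proof.
elim: n a => [|n IH] a; first by case.
move=> /admissible_stageS[adm aN].
have [nadm nmin] := next_stageP sigma n.
apply: (leq_ltn_trans (IH _ nadm)).
by rewrite ltn_neqAle nmin // andbT; apply/eqP => /esym.
Qed.

Lemma next0 : next set0 set0 = 1.
Proof.
have [[n0 _] nmin] := next_stageP (fun=> true) 0.
apply/eqP; rewrite eqn_leq n0 andbT; apply: nmin; split=> //.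
by move=> [[//|[_ [p [_ [b]]]]]|].
Qed.

Definition unit_part (sigma : nat -> bool) : set nat :=
  [set a | a = 1 /\ sigma 0].

(** The two middle clauses are the hypotheses of [least_admissible_prime], which
    keeps the first clause true from one stage to the next. *)
Lemma stage_invariant (sigma : nat -> bool) n :
  (forall n, sigma n.+1) ->
  let AB := stage sigma n.+1 in
  [/\ AB.1 `<=` unit_part sigma `|` Primes, AB.2 `<=` [set 1],
      (AB.1 `|` AB.2) 1 & unit_part sigma `<=` AB.1].
Proof.
move=> sigmaS; elim: n => [|n].
  rewrite stageS next0; case E: (sigma 0); split=> /=.
  - by move=> a [//|->]; left.
  - by [].
  - by left; right.
  - by move=> a [-> _]; right.
  - by [].
  - by move=> a [].
  - by right; right.
  - by rewrite /unit_part E => a -[].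
rewrite (stageS sigma n.+1) sigmaS; have := next_stageP sigma n.+1.
case: (stage sigma n.+1) => A B /= nextP [AP B1 AB1 UA].
have ap := least_admissible_prime _ _ _ AB1 B1 nextP.
split=> //.
- by move=> a [/AP //|->]; right.
- by case: AB1 => ?; [left; left | right].
- by move=> a /UA; left.
Qed.

Lemma F_eventually_ones (sigma : nat -> bool) :
  (forall n, sigma n.+1) -> F sigma = unit_part sigma `|` Primes.
Proof.
move=> sigmaS.
apply/seteqP; split=> a.
  move=> [[//|n] _ Aa].
  by have [AP _ _ _] := stage_invariant _ n sigmaS; apply: AP.
case=> [Ua|].
  by exists 1 => //; have [_ _ _ UA] := stage_invariant _ 0 sigmaS; apply: UA.
rewrite /Primes /=; case: a => // a ap.
exists a.+1 => //; have [AP B1 _ _] := stage_invariant _ a sigmaS.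
apply: contrapT => NA.
suff /stage_exhausts : admissible (stage sigma a.+1).1 (stage sigma a.+1).2 a.+1.
  by rewrite ltnn.
split; first by [].
case=> [[Aa|JAa]|/B1 aE]; first by apply: NA.
  have [b Ab ab] := prime_JE _ _ ap JAa.
  case: (AP _ Ab) => [[bE _]|bp].
    by move: ab; rewrite bE dvdn1 => /eqP aE; move: ap; rewrite aE.
  move: ab; rewrite (dvdn_prime2 ap (bp : prime b)) => /eqP aE.
  by apply: NA; move: Ab; rewrite -aE.
by move: ap; rewrite aE.
Qed.

Theorem mainTheorem4 :
  F (scat [:: false] ones) = Primes /\ F ones = [set 1] `|` Primes.
Proof.
split; rewrite F_eventually_ones //; apply/seteqP; split=> a.
- by case=> // -[].
- by right.
- by case=> [[-> _]|]; [left | right].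
- by case=> [->|]; [left | right].
Qed.
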